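(* Let $D=(X,Y,A)$ be an oriented split graph in which $D[Y]$ is an almost regular tournament with $2d$ vertices. Then $D$ has a Sullivan vertex, i.e. a vertex $u$ with $|N^{++}(u)|\ge |N^-(u)|$.
   Context: An oriented split graph $D=(X,Y,A)$ is an oriented graph (loopless, no pair of opposite arcs) whose vertex set is partitioned into $X$ and $Y$ with $X$ independent and $D[Y]$ a tournament. A tournament is almost regular if $|d^+(x)-d^-(x)|=1$ for each vertex $x$. $N^-(u)=\{v:vu\in A\}$, $N^+(u)=\{v:uv\in A\}$, $N^{++}(u)=\{v: uw,wv\in A\text{ for some } w\}\setminus N^+(u)$, all in $D$. *)

(* Defs.v *)
From mathcomp Require Import all_boot all_algebra.

Set Implicit Arguments.
Unset Strict Implicit.
Unset Printing Implicit Defensive.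

Section Digraphs.

Variables (V : finType) (A : rel V).

(* [A u v] means that there is an arc from [u] to [v]. *)

Definition oriented : Prop :=
  irreflexive A /\ (forall u v, ~~ (A u v && A v u)).

Definition Nout (u : V) : {set V} := [set v | A u v].
Definition Nin (u : V) : {set V} := [set v | A v u].
Definition Nout2 (u : V) : {set V} :=
  [set v | [exists w, A u w && A w v]] :\: Nout u.

Definition independent (S : {set V}) : Prop :=
  {in S &, forall u v, ~~ A u v}.

(* Properties of the subdigraph induced by [S]: degrees are counted in [S]. *)

Definition induces_tournament (S : {set V}) : Prop :=
  {in S, forall u, ~~ A u u} /\
  {in S &, forall u v, u != v -> A u v (+) A v u}.

Definition outdeg_in (S : {set V}) (u : V) : nat := #|Nout u :&: S|.
Definition indeg_in (S : {set V}) (u : V) : nat := #|Nin u :&: S|.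

Definition induces_almost_regular (S : {set V}) : Prop :=
  {in S, forall u, `|(outdeg_in S u)%:Z - (indeg_in S u)%:Z|%R = 1%R}.

Definition oriented_split (X Y : {set V}) : Prop :=
  [/\ oriented,
      X :|: Y = [set: V], [disjoint X & Y],
      independent X & induces_tournament Y].

Definition sullivan_vertex (u : V) : Prop := #|Nout2 u| >= #|Nin u|.

End Digraphs.

(* Main.v *)
Require Import Defs.
From mathcomp Require Import all_boot all_algebra.
From mathcomp Require Import zify.

Set Implicit Arguments.
Unset Strict Implicit.
Unset Printing Implicit Defensive.

(** Suppose no vertex is a Sullivan vertex. For x in X and y in Y, call y bad
    for x if x -> y and x is not reached from y in two steps, and good for x if
    x and y are nonadjacent and x is reached from y in two steps. Since a
    vertex y of D[Y] misses at most one in-neighbour in Y as a second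
    out-neighbour, and none if its out-degree in D[Y] is d, no y is good for
    more x than it is bad for, and a y of out-degree d is good for strictly
    fewer. It thus suffices to find S in Y, containing a vertex of out-degree
    d, such that every x has at most as many bad as good vertices in S.

    Counting the arcs entering [bad x :|: idle x] and those leaving [dom x]
    gives #|bad x| = #|good x| + 1 - K - P - Q with K, P, Q nonnegative
    integers. So S = Y works unless there is an exceptional x, for which
    K = P = Q = 0. Then take an exceptional x with #|bad x| minimal, y0 in
    [bad x] and S = Y minus y0: y0 is bad for every exceptional vertex, and any
    x' for which y0 is good has strictly fewer bad than good vertices. *)

(** * Degree counts in tournaments *)

Section TournamentDegrees.

Variables (V : finType) (E : rel V).

Definition tournament_on (S : {set V}) : Prop :=
  {in S, forall u, ~~ E u u} /\
  {in S &, forall u v, u != v -> E u v (+) E v u}.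

Definition nb_in (F : rel V) (S : {set V}) (u : V) : {set V} :=
  [set v in S | F u v].

(* If all arcs between S and T leave S, summing over u in S the identity
   d = #|nb_in E S u| + #|T| + defect Y d S T u gives defect_sum. *)
Definition defect (Y : {set V}) (d : nat) (S T : {set V}) (u : V) : nat :=
  d - #|nb_in E Y u| + #|nb_in E Y u :\: (S :|: T)|.

Lemma card_rel_sum (S T : {set V}) (F : rel V) :
  \sum_(u in S) #|nb_in F T u| = \sum_(v in T) #|[set u in S | F u v]|.
Proof.
have H (S' : {set V}) (P : pred V) : #|[set v in S' | P v]| = \sum_(v in S') P v.
  rewrite -sum1_card big_mkcond [RHS]big_mkcond /=.
  by apply: eq_bigr => v _; rewrite inE; case: (v \in S'); case: (P v).
under eq_bigr => u _ do rewrite H.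
by rewrite exchange_big /=; apply: eq_bigr => v _; rewrite H.
Qed.

Lemma tournament_degrees (S : {set V}) (u : V) :
  tournament_on S -> u \in S ->
  #|nb_in E S u| + #|nb_in (fun v w => E w v) S u| + 1 = #|S|.
Proof.
move=> [irr tot] uS.
set P := nb_in _ _ _; set Q := nb_in _ _ _.
have SE : S = u |: (P :|: Q).
  apply/setP=> v; rewrite !inE; case: eqVneq => [->|nvu] //=.
  case vS: (v \in S) => //=; symmetry.
  by move: (tot _ _ vS uS nvu); case: (E u v); case: (E v u).
have uPQ : u \notin P :|: Q by rewrite !inE uS (negbTE (irr _ uS)).
have dPQ : P :&: Q = set0.
  apply/setP=> v; rewrite !inE; case vS: (v \in S) => //=.
  case: (eqVneq v u) => [->|nvu]; first by rewrite (negbTE (irr _ uS)).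
  by move: (tot _ _ vS uS nvu); case: (E u v); case: (E v u).
by rewrite SE cardsU1 uPQ cardsU dPQ cards0 subn0 addnC.
Qed.

Lemma tournament_arcs (S : {set V}) :
  tournament_on S ->
  2 * \sum_(u in S) #|nb_in E S u| + #|S| = #|S| * #|S|.
Proof.
move=> tS; rewrite mul2n -addnn {2}card_rel_sum -big_split /=.
rewrite -{1}sum1_card -big_split /= -sum_nat_const; apply: eq_bigr => u uS.
exact: tournament_degrees.
Qed.

Variables (Y : {set V}) (d : nat).

(** The out-neighbours of [u] inside [S :|: T] are those in [S] and all of [T], and [S] is itself a
    tournament. The bound by [d] keeps the truncated subtraction in [defect] exact. *)
Lemma defect_sum (S T : {set V}) :
  S \subset Y -> T \subset Y -> [disjoint S & T] -> tournament_on Y ->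
  {in S, forall u, #|nb_in E Y u| <= d} ->
  {in S & T, forall u v, E u v} ->
  #|S| * (#|S| + 2 * #|T|) + 2 * \sum_(u in S) defect Y d S T u
    = #|S| * (2 * d).+1.
Proof.
move=> SY TY dST [irrY totY] degd ST.
have tS : tournament_on S.
  split=> [u /(subsetP SY)|u v /(subsetP SY) uY /(subsetP SY)]; first exact: irrY.
  exact: totY.
have key : \sum_(u in S) (defect Y d S T u + #|nb_in E S u| + #|T|)
    = \sum_(u in S) d.
  apply: eq_bigr => u uS; rewrite /defect.
  have := degd u uS; rewrite -(cardsID (S :|: T) (nb_in E Y u)).
  have -> : nb_in E Y u :&: (S :|: T) = nb_in E S u :|: T.
    apply/setP=> v; rewrite !inE.
    case vT: (v \in T); first by rewrite (subsetP TY) ?ST ?orbT.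
    rewrite !orbF; case vS: (v \in S); last by rewrite andbF.
    by rewrite (subsetP SY) ?andbT.
  rewrite cardsU.
  have -> : nb_in E S u :&: T = set0.
    apply/setP=> v; rewrite !inE; case vS: (v \in S) => //=.
    by rewrite (disjointFr dST vS) andbF.
  by rewrite cards0; lia.
move: key; rewrite !big_split /= !sum_nat_const.
have := tournament_arcs tS; lia.
Qed.

Lemma defect_sum_eq0 (S T : {set V}) :
  {in S, forall u, #|nb_in E Y u| <= d} ->
  \sum_(u in S) defect Y d S T u = 0 ->
  {in S, forall u, #|nb_in E Y u| = d /\ nb_in E Y u \subset S :|: T}.
Proof.
move=> degd /eqP; rewrite sum_nat_eq0 => /forallP H u uS.
have := H u; rewrite uS /defect addn_eq0 => /andP[/eqP h1 /eqP h2].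
split; first by have := degd u uS; lia.
by rewrite -setD_eq0 -cards_eq0 h2.
Qed.

End TournamentDegrees.

(** * The subsets of [Y] attached to a vertex of [X] *)

Section SplitGraph.

Variables (V : finType) (A : rel V) (X Y : {set V}) (d : nat).
Hypothesis hD : oriented_split A X Y.
Hypothesis hYreg : induces_almost_regular A Y.
Hypothesis hYcard : #|Y| = 2 * d.

(** Reversing arcs lets [defect_sum] count in-degrees. *)
Definition rA : rel V := fun u v => A v u.

Definition N_out (u : V) : {set V} := nb_in A Y u.
Definition N_in (u : V) : {set V} := nb_in rA Y u.

Definition nonadj (x : V) : {set V} := Y :\: (N_in x :|: N_out x).
Definition reaches (y x : V) : bool := [exists w, (w \in N_in x) && A y w].
Definition bad (x : V) : {set V} := [set y in N_out x | ~~ reaches y x].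
Definition good (x : V) : {set V} := [set y in nonadj x | reaches y x].
Definition idle (x : V) : {set V} := [set y in nonadj x | ~~ reaches y x].
(** For [x] in [X], these are the vertices of [Y] outside [N_out x] that [x] does not reach in two
    steps. *)
Definition dom (x : V) : {set V} :=
  [set u in Y :\: N_out x | [forall o in N_out x, A u o]].
Definition reachedX (x : V) : {set V} := [set x' in X | [exists o in N_out x, A o x']].

Lemma irr : irreflexive A.
Proof. by case: hD => -[]. Qed.

Lemma asym u v : A u v -> A v u = false.
Proof. by case: hD => -[_ /(_ u v)]; rewrite negb_and => /orP[] /negbTE->. Qed.

Lemma inXY v : (v \in X) = (v \notin Y).
Proof.
case: hD => _ /setP/(_ v) XY dXY _ _; move: XY; rewrite !inE.
case vX: (v \in X); first by rewrite (disjointFr dXY vX).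
by move=> /= ->.
Qed.

Lemma indep u v : u \in X -> v \in X -> A u v = false.
Proof. by case: hD => _ _ _ H _ uX vX; apply/negbTE/H. Qed.

Lemma tour u v : u \in Y -> v \in Y -> u != v -> A u v = false -> A v u.
Proof.
by case: hD => _ _ _ _ [_ H] uY vY /(H _ _ uY vY) + nuv; rewrite nuv.
Qed.

Lemma tourA : tournament_on A Y.
Proof. by case: hD => _ _ _ _ []. Qed.

Lemma tourrA : tournament_on rA Y.
Proof.
case: tourA => h1 h2; split=> // u v uY vY nuv.
by rewrite /rA addbC; apply: h2.
Qed.

Lemma degrees u : u \in Y ->
  (#|N_out u| = d /\ #|N_in u| + 1 = d) \/ (#|N_out u| + 1 = d /\ #|N_in u| = d).
Proof.
move=> uY; have := tournament_degrees tourA uY; rewrite hYcard.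
rewrite -/(N_out u) -/rA -/(N_in u).
have := hYreg uY; rewrite /outdeg_in /indeg_in.
have -> : Nout A u :&: Y = N_out u by apply/setP=> v; rewrite !inE andbC.
have -> : Nin A u :&: Y = N_in u by apply/setP=> v; rewrite !inE andbC.
lia.
Qed.

Lemma out_le u : u \in Y -> #|N_out u| <= d.
Proof. by move=> /degrees; lia. Qed.

Lemma in_le u : u \in Y -> #|N_in u| <= d.
Proof. by move=> /degrees; lia. Qed.

Lemma in_out_disj u v : v \in N_in u -> v \notin N_out u.
Proof. by rewrite !inE => /andP[-> /asym]; rewrite andTb => ->. Qed.

Lemma card_parts x : x \in X -> #|N_in x| + #|N_out x| + #|nonadj x| = 2 * d.
Proof.
move=> xX; rewrite -hYcard -(cardsID (N_in x :|: N_out x) Y) -/(nonadj x).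
congr (_ + _); have -> : Y :&: (N_in x :|: N_out x) = N_in x :|: N_out x.
  by apply/setIidPr; apply/subsetP=> v; rewrite !inE => /orP[] /andP[].
rewrite cardsU; have -> : N_in x :&: N_out x = set0; last by rewrite cards0 subn0.
apply/setP=> v; rewrite inE in_set0; apply/negbTE/negP => /andP[/in_out_disj].
by move=> /negP.
Qed.

Lemma card_nonadj x : #|nonadj x| = #|good x| + #|idle x|.
Proof.
rewrite -(cardsID [set y | reaches y x] (nonadj x)).
by congr (_ + _); apply: eq_card => y; rewrite !inE // andbC.
Qed.

Lemma card_bad_idle x : #|bad x :|: idle x| = #|bad x| + #|idle x|.
Proof.
rewrite cardsU; have -> : bad x :&: idle x = set0; last by rewrite cards0 subn0.
apply/setP=> y; rewrite !inE.
by case: (y \in Y); case: (A x y); rewrite ?orbT ?andbF //.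
Qed.

Lemma sub_bi_Y x : bad x :|: idle x \subset Y.
Proof.
by apply/subsetP=> y; rewrite !inE => /orP[/andP[/andP[->]]|/andP[/andP[_ ->]]].
Qed.

(** An arc from [v] to [u] would make [v] reach [x] through [u]. *)
Lemma in_to_bi x u v : u \in N_in x -> v \in bad x :|: idle x -> A u v.
Proof.
move=> uI vB; have vY := subsetP (sub_bi_Y x) _ vB.
have uY : u \in Y by move: uI; rewrite inE => /andP[].
have nr : ~~ reaches v x by move: vB; rewrite !inE => /orP[] /andP[].
have nvI : v \notin N_in x.
  move: vB; rewrite inE => /orP[|].
    by rewrite inE => /andP[vO _]; apply/negP => /in_out_disj; rewrite vO.
  by rewrite !inE negb_or => /andP[/andP[/andP[]]].
apply: (tour vY uY); first by apply: contra nvI => /eqP->.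
apply/negbTE; apply: contra nr => Avu.
by apply/existsP; exists u; rewrite uI.
Qed.

Lemma dom_sub x : dom x \subset Y.
Proof. by apply/subsetP=> u; rewrite !inE => /andP[/andP[]]. Qed.

Lemma dom_to_out x u v : u \in dom x -> v \in N_out x -> A u v.
Proof. by rewrite inE => /andP[_ /forall_inP H] /H. Qed.

Lemma dom_notout x u : u \in dom x -> u \notin N_out x.
Proof. by rewrite inE in_setD => /andP[/andP[]]. Qed.

(** * Arcs entering [bad x :|: idle x] and arcs leaving [dom x] *)

Definition E_in x := \sum_(u in bad x :|: idle x)
  defect rA Y d (bad x :|: idle x) (N_in x) u.
Definition E_out x := \sum_(u in dom x) defect A Y d (dom x) (N_out x) u.

Lemma in_count x :
  #|bad x :|: idle x| * (#|bad x :|: idle x| + 2 * #|N_in x|) + 2 * E_in x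
    = #|bad x :|: idle x| * (2 * d).+1.
Proof.
apply: (defect_sum (sub_bi_Y x) _ _ tourrA).
- by apply/subsetP=> v; rewrite inE => /andP[].
- rewrite disjoint_subset; apply/subsetP=> v vB; apply/negP => vI.
  by have := in_to_bi vI vB; rewrite irr.
- by move=> u /(subsetP (sub_bi_Y x)) /in_le.
- by move=> u v uB vI; apply: in_to_bi vI uB.
Qed.

Lemma out_count x :
  #|dom x| * (#|dom x| + 2 * #|N_out x|) + 2 * E_out x = #|dom x| * (2 * d).+1.
Proof.
apply: (defect_sum (dom_sub x) _ _ tourA).
- by apply/subsetP=> v; rewrite inE => /andP[].
- rewrite disjoint_subset; apply/subsetP=> v; exact: dom_notout.
- by move=> u /(subsetP (dom_sub x)) /out_le.
- by move=> u v uB vI; apply: dom_to_out uB vI.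
Qed.

Lemma Nin_X x : x \in X -> Nin A x = N_in x.
Proof.
move=> xX; apply/setP=> v; rewrite !inE; case vY: (v \in Y) => //=.
by apply: indep => //; rewrite inXY vY.
Qed.

(** In two steps [x] reaches [reachedX x] and all of [Y :\: N_out x] outside [dom x]; together these
    must be fewer than [N_in x]. *)
Lemma dom_gt x : x \in X -> ~ sullivan_vertex A x ->
  #|nonadj x| + #|reachedX x| < #|dom x|.
Proof.
move=> xX; rewrite /sullivan_vertex (Nin_X xX) => /negP; rewrite -ltnNge => h.
have sub : (Y :\: N_out x :\: dom x) :|: reachedX x \subset Nout2 A x.
  apply/subsetP=> v; rewrite inE => /orP[].
    rewrite !inE => /andP[+ /andP[+ vY]]; rewrite vY /= => + nxv.
    rewrite nxv /= => /forall_inPn /= [o oO nvo]; apply/existsP; exists o.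
    move: (oO); rewrite inE => /andP[oY ->] /=.
    apply: (tour vY oY); last exact/negbTE.
    by apply/eqP=> vo; move: oO nxv; rewrite !inE -vo => /andP[_ ->].
  rewrite !inE => /andP[vX /exists_inP[o]]; rewrite inE => /andP[oY xo] ov.
  by rewrite indep //=; apply/existsP; exists o; rewrite xo.
have dsub : dom x \subset Y :\: N_out x.
  by apply/subsetP=> u; rewrite inE => /andP[].
have osub : N_out x \subset Y by apply/subsetP=> v; rewrite inE => /andP[].
have c1 : #|Y :\: N_out x| + #|N_out x| = 2 * d.
  by have := cardsID (N_out x) Y; rewrite hYcard (setIidPr osub) addnC.
have c2 : #|Y :\: N_out x :\: dom x| + #|dom x| = #|Y :\: N_out x|.
  by have := cardsID (dom x) (Y :\: N_out x); rewrite (setIidPr dsub) addnC.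
have c3 : [disjoint Y :\: N_out x :\: dom x & reachedX x].
  rewrite disjoint_subset; apply/subsetP=> v; rewrite !inE inXY.
  by case: (v \in Y) => //=; rewrite ?andbF.
have := subset_leq_card sub.
rewrite cardsU disjoint_setI0 // cards0 subn0.
have := card_parts xX; lia.
Qed.

(** * The balance of bad and good vertices without Sullivan vertices *)

Hypothesis noS : forall u, ~ sullivan_vertex A u.

(** [P] and [Q] are twice the average defects in the two arc counts, and [K] is the slack in
    [dom_gt]. Adding them up with [card_parts] and [card_nonadj] gives the last equation. *)
Lemma bad_idle_balance x : x \in X -> 0 < #|bad x| ->
  exists P Q K,
  [/\ 2 * d + 1 = #|bad x| + #|idle x| + 2 * #|N_in x| + P,
      (#|bad x| + #|idle x|) * P = 2 * E_in x,
      #|dom x| * Q = 2 * E_out x,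
      #|dom x| = #|nonadj x| + 1 + K /\ #|reachedX x| <= K
    & #|bad x| + K + P + Q = #|good x| + 1].
Proof.
move=> xX b0; have wgt := dom_gt xX (@noS x).
have cp := card_parts xX; have cn := card_nonadj x.
have := in_count x; have := out_count x; rewrite card_bad_idle.
set b := #|bad x| in b0 *; set r := #|idle x| in cn *; set i := #|N_in x| in cp *.
set o := #|N_out x| in cp *; set w := #|dom x| in wgt *.
set ei := E_in x; set eo := E_out x => ho hi.
have w0 : 0 < w by lia.
(* Cancelling the positive set size in each count shows that the subtractions defining [P] and [Q]
   are not truncated. *)
have lo : w + 2 * o <= (2 * d).+1 by rewrite -(leq_pmul2l w0); lia.
have li : b + r + 2 * i <= (2 * d).+1.
  by rewrite -(@leq_pmul2l (b + r)) ?addn_gt0 ?b0 //; lia.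
exists ((2 * d).+1 - (b + r + 2 * i)), ((2 * d).+1 - (w + 2 * o)).
exists (w - #|nonadj x| - 1); split; try lia.
- by rewrite mulnBr; lia.
- by rewrite mulnBr; lia.
Qed.

Lemma E_in_eq0 x u : E_in x = 0 -> u \in bad x :|: idle x ->
  #|N_in u| = d /\ N_in u \subset bad x :|: idle x :|: N_in x.
Proof.
move=> h; apply: (defect_sum_eq0 _ h) => v /(subsetP (sub_bi_Y x)).
exact: in_le.
Qed.

Lemma E_out_eq0 x u : E_out x = 0 -> u \in dom x ->
  #|N_out u| = d /\ N_out u \subset dom x :|: N_out x.
Proof.
by move=> h; apply: (defect_sum_eq0 _ h) => v /(subsetP (dom_sub x)) /out_le.
Qed.

(** By size, some [w] in [dom x] is adjacent to [x], hence in [N_in x]. It dominates [idle x], and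
    zero defect keeps its out-neighbours in [Y] inside [dom x :|: N_out x]. *)
Lemma idle_sub_dom x :
  #|nonadj x| < #|dom x| -> E_out x = 0 -> idle x \subset dom x.
Proof.
move=> lt e0; apply/subsetP=> u uR.
have /subsetPn[w wW wZ] : ~~ (dom x \subset nonadj x).
  by apply/negP => /subset_leq_card; rewrite leqNgt lt.
have wI : w \in N_in x.
  have wY := subsetP (dom_sub x) _ wW; have wO := dom_notout wW.
  by move: wZ; rewrite inE wY andbT negbK inE (negbTE wO) orbF.
have uS : u \in bad x :|: idle x by rewrite inE uR orbT.
have [_ /subsetP/(_ u)] := E_out_eq0 e0 wW.
rewrite inE (subsetP (sub_bi_Y x) _ uS) (in_to_bi wI uS) => /(_ isT).
rewrite inE => /orP[] // uO; move: uR.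
by rewrite inE inE inE uO orbT.
Qed.

Lemma degree_clash u : u \in Y -> #|N_out u| = d -> #|N_in u| = d -> False.
Proof. by move=> /degrees; lia. Qed.

(** An idle vertex would lie in [dom x] and have both degrees in [Y] equal to [d]. *)
Lemma idle_eq0 x :
  #|nonadj x| < #|dom x| -> E_out x = 0 -> E_in x = 0 -> idle x = set0.
Proof.
move=> lt e0 e1; apply/eqP; rewrite -subset0; apply/subsetP=> u uR.
have uS : u \in bad x :|: idle x by rewrite inE uR orbT.
have [h1 _] := E_out_eq0 e0 (subsetP (idle_sub_dom lt e0) _ uR).
have [h2 _] := E_in_eq0 e1 uS.
by case: (degree_clash (subsetP (sub_bi_Y x) _ uS) h1 h2).
Qed.

Lemma reachedX0 x x' o : #|reachedX x| = 0 -> x' \in X -> o \in N_out x ->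
  A o x' = false.
Proof.
move=> /eqP; rewrite cards_eq0 => /eqP/setP/(_ x') + xX oO.
rewrite !inE xX /= => h; apply/negbTE/negP => ox.
by move/negbT/negP: h; apply; apply/exists_inP; exists o.
Qed.

(** * Exceptional vertices of [X] *)

Definition exceptional x := (x \in X) && (#|good x| < #|bad x|).

(** The balance forces [K], [P] and [Q] to vanish, so both defect sums vanish and [idle x] is
    empty. *)
Lemma exceptional_structure x : exceptional x ->
  [/\ #|reachedX x| = 0, E_out x = 0,
      {in bad x, forall c, #|N_in c| = d /\ N_in c \subset bad x :|: N_in x},
      #|bad x| = #|good x| + 1
    & #|dom x| = #|nonadj x| + 1 /\ 2 * #|N_in x| + #|nonadj x| = 2 * d].
Proof.
move=> /andP[xX gb]; have b0 : 0 < #|bad x| by lia.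
have [P [Q [K [h1 h2 h3 [h4 h5] h6]]]] := bad_idle_balance xX b0.
have P0 : P = 0 by lia.
have Q0 : Q = 0 by lia.
have e1 : E_in x = 0 by move: h2; rewrite P0 muln0; lia.
have e0 : E_out x = 0 by move: h3; rewrite Q0 muln0; lia.
have lt : #|nonadj x| < #|dom x| by lia.
have i0 := idle_eq0 lt e0 e1.
have cn := card_nonadj x; rewrite i0 cards0 in cn h1.
split; try lia.
move=> c cB; have := @E_in_eq0 x c e1; rewrite i0 setU0; exact.
Qed.

Lemma bad_out x c : c \in bad x -> c \in N_out x.
Proof. by rewrite inE => /andP[]. Qed.

Lemma out_Y x c : c \in N_out x -> c \in Y.
Proof. by rewrite inE => /andP[]. Qed.

Lemma in_Y x c : c \in N_in x -> c \in Y.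
Proof. by rewrite inE => /andP[]. Qed.

Lemma bad_bi x c : c \in bad x -> c \in bad x :|: idle x.
Proof. by rewrite in_setU => ->. Qed.

(** If [y0] were not bad for [x'], every [c] in [bad x'] would have an arc to [y0] and hence lie in
    [bad x]; then [bad x'] would be smaller than [bad x]. *)
Lemma exceptional_common x x' y0 : exceptional x -> exceptional x' ->
  #|bad x| <= #|bad x'| -> y0 \in bad x -> y0 \in bad x'.
Proof.
move=> ex ex' le yB; apply/negPn/negP => nyB.
have [r0 _ hB _ _] := exceptional_structure ex.
have [r0' _ hB' _ _] := exceptional_structure ex'.
have xX : x \in X by case/andP: ex.
have xX' : x' \in X by case/andP: ex'.
have sub : bad x' \subset bad x :\ y0.
  apply/subsetP=> c cB'; rewrite in_setD1.
  have cy : c != y0 by apply: contraNneq nyB => <-.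
  rewrite cy /=.
  have cY := out_Y (bad_out cB'); have yY := out_Y (bad_out yB).
  (* In-neighbours of [c] in [Y] lie in [bad x' :|: N_in x'], and [y0] is not in [N_in x'] because
     [reachedX x] is empty. *)
  have yc : A y0 c = false.
    apply/negbTE/negP => yc.
    have [_ /subsetP/(_ y0)] := hB' _ cB'; rewrite inE yY => /(_ yc).
    rewrite inE (negbTE nyB) /= inE => /andP[_].
    by rewrite /rA (reachedX0 r0 xX' (bad_out yB)).
  have cy' : A c y0 by apply: (tour yY cY) => //; rewrite eq_sym.
  have [_ /subsetP/(_ c)] := hB _ yB; rewrite inE cY => /(_ cy').
  rewrite inE => /orP[] //; rewrite inE => /andP[_].
  by rewrite /rA (reachedX0 r0' xX (bad_out cB')).
have := subset_leq_card sub; have := cardsD1 y0 (bad x); rewrite yB; lia.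
Qed.

(** Otherwise the balance leaves [K + P + Q <= 1]. Arcs from [y0] to [bad x'] are forced by [K = 0]
    and excluded by [P = 0], so exactly one of [K] and [P] is 1; each case fails by counting. *)
Lemma good_strict x x' y0 : exceptional x -> y0 \in bad x ->
  x' \in X -> y0 \in good x' -> #|bad x'| < #|good x'|.
Proof.
move=> ex yB xX' yG; rewrite ltnNge; apply/negP => gb.
have g0 : 0 < #|good x'| by apply/card_gt0P; exists y0.
have b0 : 0 < #|bad x'| by lia.
have [c0 cB0] : exists c, c \in bad x' by apply/card_gt0P.
have [P [Q [K [h1 h2 h3 [h4 h5] h6]]]] := bad_idle_balance xX' b0.
have [r0 e0 hB hb [hw hz]] := exceptional_structure ex.
have xX : x \in X by case/andP: ex.
have lt : #|nonadj x'| < #|dom x'| by lia.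
have rK : K = 0 -> #|reachedX x'| = 0 by lia.
have eP : P = 0 -> E_in x' = 0 by move=> P0; rewrite P0 muln0 in h2; lia.
have eQ : Q = 0 -> E_out x' = 0 by move=> Q0; rewrite Q0 muln0 in h3; lia.
have KPQ : K + P + Q <= 1 by lia.
have yY := out_Y (bad_out yB).
have [i' iI yi] : exists2 i', i' \in N_in x' & A y0 i'.
  by move: yG; rewrite inE => /andP[_ /existsP[i' /andP[]]]; exists i'.
have iX : A i' x' by move: iI; rewrite inE => /andP[].
have niO : i' \notin N_out x.
  by apply/negP => /(reachedX0 r0 xX'); rewrite iX.
have niI : i' \notin N_in x.
  by apply/negP => /in_to_bi/(_ (bad_bi yB)) /asym; rewrite yi.
have ynout : y0 \notin bad x' :|: idle x' :|: N_in x'.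
  have [yZ yR] : y0 \in nonadj x' /\ reaches y0 x'.
    by apply/andP; move: yG; rewrite inE.
  have ynI : y0 \notin N_in x'.
    by move: yZ; rewrite in_setD in_setU negb_or => /andP[/andP[]].
  rewrite in_setU (negbTE ynI) orbF in_setU.
  by rewrite [_ \in bad _]inE [_ \in idle _]inE yR !andbF.
(* If [c] were bad for [x], its in-neighbour [i'] would be in [bad x :|: N_in x], but [i'] is not
   adjacent to [x]. So [c] is outside [bad x :|: N_in x], which holds all in-neighbours of [y0] in
   [Y]. *)
have to c : c \in bad x' -> c \notin N_in x -> A y0 c.
  move=> cB' cI; have ncB : c \notin bad x.
    apply/negP => cB; have [_ /subsetP/(_ i')] := hB _ cB.
    rewrite inE (in_Y iI) => /(_ (in_to_bi iI (bad_bi cB'))).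
    by rewrite inE (negbTE niI) orbF => /bad_out; rewrite (negbTE niO).
  have cY := out_Y (bad_out cB').
  apply: (tour cY yY); first by apply: contraNneq ncB => ->.
  apply/negbTE/negP => cy.
  have [_ /subsetP/(_ c)] := hB _ yB; rewrite inE cY => /(_ cy).
  by rewrite inE (negbTE ncB) (negbTE cI).
have toK c : K = 0 -> c \in bad x' -> A y0 c.
  move=> K0 cB; apply: to => //; apply/negP; rewrite inE => /andP[_].
  by rewrite /rA (reachedX0 (rK K0) xX (bad_out cB)).
have toP c : P = 0 -> c \in bad x' -> A y0 c = false.
  move=> P0 cB; apply/negbTE; apply: contra ynout => yc.
  have [_ /subsetP] := E_in_eq0 (eP P0) (bad_bi cB); apply.
  by rewrite inE yY.
have [P0|P0] := posnP P.
  have [K0|K0] := posnP K; first by have := toK c0 K0 cB0; rewrite toP.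
  (* Here [K = 1] and [P = Q = 0]. The sets [N_in x'], [dom x] and [bad x'] are disjoint and avoid
     [N_out x], but [Y :\: N_out x] is too small for them. *)
  have e1 := eP P0.
  have eo : E_out x' = 0 by apply: eQ; clear - KPQ K0; lia.
  have i0 := idle_eq0 lt eo e1.
  have bI c : c \in bad x' -> c \in N_in x.
    by move=> cB; apply/negPn/negP => /(to _ cB); rewrite toP.
  have bW c : c \in bad x' -> c \notin dom x.
    move=> cB; apply/negP => cW; have [d1 _] := E_out_eq0 e0 cW.
    have [d2 _] := E_in_eq0 e1 (bad_bi cB).
    exact: degree_clash (subsetP (dom_sub x) _ cW) d1 d2.
  have IW c : c \in N_in x' -> c \notin dom x.
    move=> cI; apply/negP => cW; have [_ /subsetP/(_ c0)] := E_out_eq0 e0 cW.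
    rewrite inE (out_Y (bad_out cB0)) => /(_ (in_to_bi cI (bad_bi cB0))).
    rewrite inE (negbTE (bW _ cB0)) /=; apply/negP.
    exact: in_out_disj (bI _ cB0).
  have sub : N_in x' :|: (dom x :|: bad x') \subset N_in x :|: nonadj x.
    have H c : c \in Y -> c \notin N_out x -> c \in N_in x :|: nonadj x.
      move=> cY cO; rewrite inE in_setD in_setU (negbTE cO) cY orbF andbT.
      exact: orbN.
    apply/subsetP=> c /setUP[cI|/setUP[cW|cB]].
    - apply: H; first exact: in_Y cI.
      apply/negP => cO; move: cI; rewrite inE => /andP[_].
      by rewrite /rA (reachedX0 r0 xX' cO).
    - by apply: H; [apply: (subsetP (dom_sub x)) | apply: dom_notout].
    - by rewrite in_setU bI.
  have d1 : [disjoint dom x & bad x'].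
    rewrite disjoint_sym disjoint_subset; apply/subsetP=> c; exact: bW.
  have d2 : [disjoint N_in x' & dom x :|: bad x'].
    rewrite disjoint_subset; apply/subsetP=> c cI.
    rewrite inE in_setU (negbTE (IW _ cI)) /=.
    by apply/negP => /bad_out; apply/negP/in_out_disj.
  have := subset_leq_card sub.
  rewrite !cardsU (disjoint_setI0 d2) (disjoint_setI0 d1) cards0.
  rewrite i0 cards0 P0 in h1; clear - h1 hw hz; lia.
have [K0 Q0 P1] : [/\ K = 0, Q = 0 & P = 1] by clear - KPQ P0; split; lia.
have eo := eQ Q0.
(* Every term has positive defect: a bad vertex has the outside in-neighbour [y0], and an idle one
   has out-degree [d], so in-degree [d - 1]. Yet [P = 1] means an average defect of 1/2. *)
have : \sum_(u in bad x' :|: idle x') 1 <= E_in x'.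
  apply: leq_sum => c /setUP[cB|cR]; rewrite /defect -/(N_in c).
    apply: leq_trans (leq_addl _ _); apply/card_gt0P; exists y0.
    by rewrite in_setD ynout inE yY; apply: toK.
  have cW := subsetP (idle_sub_dom lt eo) _ cR.
  have [dc _] := E_out_eq0 eo cW.
  by have := degrees (subsetP (dom_sub _) _ cW); rewrite dc; clear; lia.
by rewrite sum1_card card_bad_idle; move: h2; rewrite P1; clear - b0; lia.
Qed.

(** * Second out-neighbours of vertices of [Y] *)

Definition unreached_in (y : V) : {set V} :=
  [set v in N_in y | [forall w in N_out y, ~~ A w v]].

(** Such a [v] dominates [y] and [N_out y], so it has larger out-degree in [Y]; the only possible
    values are [d - 1] and [d]. *)
Lemma unreached_in_out y v : y \in Y -> v \in unreached_in y ->
  [/\ v \in Y, A v y, y |: N_out y \subset N_out v & #|N_out v| = #|N_out y| + 1].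
Proof.
move=> yY; rewrite inE => /andP[]; rewrite inE => /andP[vY vy] /forall_inP nr.
have sub : y |: N_out y \subset N_out v.
  apply/subsetP=> w /setU1P[->|wO]; first by rewrite inE yY.
  have wY := out_Y wO; rewrite inE wY /=.
  apply: (tour wY vY); last by apply/negbTE/nr.
  by apply/eqP => wv; move: wO; rewrite inE wv (asym vy) andbF.
have yO : y \notin N_out y by rewrite inE irr andbF.
split=> //; have := subset_leq_card sub; rewrite cardsU1 yO.
have := degrees vY; have := degrees yY; clear; lia.
Qed.

(** Each unreached vertex has [y |: N_out y] as its whole out-neighbourhood in [Y]. This contains no
    in-neighbour of [y], so two unreached vertices would be nonadjacent. *)
Lemma card_unreached_in y : y \in Y -> #|unreached_in y| <= 1.
Proof.
move=> yY; apply/card_le1_eqP => u v uT vT; apply/eqP/negPn/negP => nuv.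
have H a b : a \in unreached_in y -> b \in unreached_in y -> A a b = false.
  move=> aT bT; have [aY ay sa ca] := unreached_in_out yY aT.
  have [bY yb _ _] := unreached_in_out yY bT.
  have yO : y \notin N_out y by rewrite inE irr andbF.
  have EO : y |: N_out y = N_out a.
    by apply/eqP; rewrite eqEcard sa cardsU1 yO ca addnC leqnn.
  apply/negbTE/negP => ab; have : b \in N_out a by rewrite inE bY.
  rewrite -EO => /setU1P[bE|]; first by rewrite bE irr in yb.
  by rewrite inE (asym yb) andbF.
have [uY _ _ _] := unreached_in_out yY uT; have [vY _ _ _] := unreached_in_out yY vT.
by have := H _ _ uT vT; rewrite (tour vY uY nuv) // H.
Qed.

Lemma unreached_in_eq0 y : y \in Y -> #|N_out y| = d -> #|unreached_in y| = 0.
Proof.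
move=> yY dy; apply/eqP; rewrite cards_eq0 -subset0; apply/subsetP=> v vT.
have [vY _ _ cv] := unreached_in_out yY vT.
by have := out_le vY; rewrite cv dy addn1 ltnn.
Qed.

(** In-neighbours [x] of [y] in [X] either have [y] bad or are reached from [y]. The latter form
    [c], which also lies in [Nout2 A y] and cancels. *)
Lemma good_lt_bad y : y \in Y ->
  #|[set x in X | y \in good x]| <
    #|[set x in X | y \in bad x]| + #|unreached_in y|.
Proof.
move=> yY; have /negP := @noS y; rewrite /sullivan_vertex -ltnNge.
set g := [set x in X | _]; set b := [set x in X | _].
pose c := [set x in X | A x y && reaches y x].
have outE x : (y \in N_out x) = A x y by rewrite inE yY.
have -> : Nin A y = N_in y :|: (b :|: c).
  apply/setP=> v; rewrite !inE yY inXY; case: (v \in Y) => //=; first by rewrite orbF.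
  by rewrite -andb_orr orNb andbT.
have sub : (N_in y :\: unreached_in y) :|: (g :|: c) \subset Nout2 A y.
  have reached x : x \in X -> reaches y x -> [exists w, A y w && A w x].
    move=> xX /existsP[w]; rewrite inE => /andP[/andP[_ wx] yw].
    by apply/existsP; exists w; rewrite yw.
  apply/subsetP=> v /setUP[/setDP[vI vT]|/setUP[]].
  - have vy : A v y by move: vI; rewrite inE => /andP[].
    rewrite in_setD !inE (asym vy) /=.
    move: vT; rewrite inE vI => /forall_inPn[w wO /negPn wv].
    by apply/existsP; exists w; move: wO; rewrite inE => /andP[_ ->].
  - rewrite inE => /andP[vX]; rewrite inE => /andP[vZ vr].
    rewrite in_setD !inE reached // andbT.
    by move: vZ; rewrite in_setD in_setU negb_or inE yY => /andP[/andP[]].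
  - rewrite inE => /and3P[vX vy vr].
    by rewrite in_setD !inE reached // (asym vy).
have dXY (S S' : {set V}) : S \subset Y -> S' \subset X -> S :&: S' = set0.
  move=> sS sS'; apply/setP=> v; rewrite in_setI in_set0.
  apply/negbTE/negP => /andP[/(subsetP sS) vY /(subsetP sS')].
  by rewrite inXY vY.
have sX (P : pred V) : [set x in X | P x] \subset X.
  by apply/subsetP=> v; rewrite inE => /andP[].
have IY : N_in y \subset Y by apply/subsetP=> v; exact: in_Y.
have bc : b :&: c = set0.
  apply/setP=> v; rewrite in_setI in_set0; apply/negbTE/negP => /andP[].
  rewrite !inE => /andP[_ /andP[_ /negP nr]] /and3P[_ _]; exact: nr.
have gc : g :&: c = set0.
  apply/setP=> v; rewrite in_setI in_set0; apply/negbTE/negP => /andP[].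
  rewrite inE => /andP[_]; rewrite inE => /andP[yZ _]; rewrite inE => /and3P[_ vy _].
  by move: yZ; rewrite in_setD in_setU outE vy orbT.
have TI : unreached_in y \subset N_in y by apply/subsetP=> v; rewrite inE => /andP[].
have DT := cardsID (unreached_in y) (N_in y); rewrite (setIidPr TI) in DT.
have d1 : N_in y :&: (b :|: c) = set0 by apply: dXY; rewrite ?subUset ?sX.
have d2 : (N_in y :\: unreached_in y) :&: (g :|: c) = set0.
  by apply: dXY; rewrite ?subUset ?sX // (subset_trans (subsetDl _ _)).
have := subset_leq_card sub; rewrite !cardsU bc gc d1 d2 cards0.
move: DT; clear; lia.
Qed.

(** * Double counting of bad and good pairs *)

Lemma weighted_sum_absurd (S : {set V}) y1 :
  S \subset Y -> y1 \in S -> #|N_out y1| = d ->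
  {in X, forall x, #|S :&: bad x| <= #|S :&: good x|} -> False.
Proof.
move=> SY y1S d1 H.
have le : \sum_(y in S) #|[set x in X | y \in bad x]|
       <= \sum_(y in S) #|[set x in X | y \in good x]|.
  rewrite -(card_rel_sum _ _ (fun x y => y \in bad x)).
  rewrite -(card_rel_sum _ _ (fun x y => y \in good x)).
  have nbE (F : V -> {set V}) x : nb_in (fun x y => y \in F x) S x = S :&: F x.
    by apply/setP=> y; rewrite !inE.
  by apply: leq_sum => x xX; rewrite !nbE H.
move: le; rewrite leqNgt => /negP; apply.
(* Strictness comes from the term [y1], where [unreached_in] is empty. *)
rewrite (bigD1 y1 y1S) [X in _ < X](bigD1 y1 y1S) /= -addSn; apply: leq_add.
  have y1Y := subsetP SY _ y1S.
  by have := good_lt_bad y1Y; rewrite unreached_in_eq0 // addn0.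
apply: leq_sum => y /andP[/(subsetP SY) yY _].
by have := good_lt_bad yY; have := card_unreached_in yY; clear; lia.
Qed.

(** With all out-degrees [d - 1] there would be fewer than the [d * (2 * d - 1)] arcs of a
    tournament. *)
Lemma exists_outdeg_d : 0 < d -> exists2 y, y \in Y & #|N_out y| = d.
Proof.
move=> d0; have [/exists_inP[y yY /eqP]|/exists_inPn /= H] :=
  boolP [exists y in Y, #|N_out y| == d]; first by exists y.
exfalso.
have : \sum_(y in Y) (#|N_out y| + 1) = \sum_(y in Y) d.
  apply: eq_bigr => y yY; have := degrees yY; move: (H _ yY); clear; lia.
rewrite big_split /= !sum_nat_const hYcard.
have : 2 * (\sum_(u in Y) #|N_out u|) + #|Y| = #|Y| * #|Y|.
  exact: tournament_arcs tourA.
rewrite hYcard; move: (\sum_(u in Y) _) => e.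
move: d0; clear; nia.
Qed.

Lemma no_sullivan_absurd : 0 < #|V| -> False.
Proof.
move=> V0; have [d0|d0] := posnP d.
  (* With [Y] empty, no vertex has an in-neighbour. *)
  have Y0 : Y = set0 by apply/eqP; rewrite -cards_eq0 hYcard d0.
  have [u _] := card_gt0P V0; apply: (@noS u); rewrite /sullivan_vertex.
  have uX : u \in X by rewrite inXY Y0 inE.
  rewrite (Nin_X uX) (_ : N_in u = set0) ?cards0 //.
  by apply/setP=> v; rewrite !inE Y0 inE.
have [y1 y1Y d1] := exists_outdeg_d d0.
have YI (S : {set V}) : S \subset Y -> Y :&: S = S by move=> /setIidPr.
have badY x : bad x \subset Y by apply/subsetP=> c /bad_out/out_Y.
have goodY x : good x \subset Y.
  by apply/subsetP=> c; rewrite inE => /andP[]; rewrite inE => /andP[].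
have [/existsP[x1 ex1]|/existsPn nex] := boolP [exists x, exceptional x]; last first.
  apply: (weighted_sum_absurd (subxx Y) y1Y d1) => x xX.
  rewrite !YI //; have := nex x; rewrite /exceptional xX /=; clear; lia.
have [x ex minx] : exists2 x, exceptional x &
    forall x', exceptional x' -> #|bad x| <= #|bad x'|.
  by case: (arg_minnP (fun x => #|bad x|) ex1) => x ex minx; exists x.
have [_ _ hB hb _] := exceptional_structure ex.
have [y0 yB] : exists y, y \in bad x.
  by apply/card_gt0P; rewrite hb addn1.
have [d0' _] := hB _ yB.
(* [y0] has in-degree [d] in [Y], so it differs from [y1]. *)
have y1S : y1 \in Y :\ y0.
  rewrite in_setD1 y1Y andbT; apply/eqP => E; rewrite E in d1 y1Y.
  exact: degree_clash y1Y d1 d0'.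
have SY : Y :\ y0 \subset Y by exact: subD1set.
apply: (weighted_sum_absurd SY y1S d1) => x' xX'.
rewrite !setIDAC !YI //.
have := cardsD1 y0 (bad x'); have := cardsD1 y0 (good x').
(* Removing [y0] costs an exceptional [x'] one bad vertex and no good one, which closes its gap of
   1. For other [x'], the loss of a good vertex is absorbed by [good_strict]. *)
have [ex'|nex'] := boolP (exceptional x').
  have yB' := exceptional_common ex ex' (minx _ ex') yB.
  have /negbTE-> : y0 \notin good x'.
    by move: yB'; rewrite !inE => /andP[_ /negbTE->]; rewrite andbF.
  rewrite yB'.
  have [_ _ _ -> _] := exceptional_structure ex'; clear; lia.
have le : #|bad x'| <= #|good x'|.
  by move: nex'; rewrite /exceptional xX' /= -leqNgt.
have [yG|_] := boolP (y0 \in good x'); last by move: le; clear; lia.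
by have := good_strict ex yB xX' yG; clear; lia.
Qed.

End SplitGraph.

Theorem theorem4p8 (V : finType) (A : rel V) (X Y : {set V}) (d : nat)
    (hV : 0 < #|V|)
    (hD : oriented_split A X Y)
    (hYreg : induces_almost_regular A Y)
    (hYcard : #|Y| = 2 * d) :
  exists u : V, sullivan_vertex A u.
Proof.
have [/existsP //|/existsPn noS] := boolP [exists u, #|Nin A u| <= #|Nout2 A u|].
by case: (no_sullivan_absurd hD hYreg hYcard (fun u => negP (noS u)) hV).
Qed.
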